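(* Let $1\le r\le k$ be integers and fix an integer $i$ with $1\le i\le r$. Then there exists a rational constant $c$ such that, in $\mathcal{A}$, $$\sum_{\substack{k_1+\cdots+k_r=k\\ k_i \text{ odd},\ k_j \text{ even for all } j\neq i}}\zeta_{\mathcal{A}}^{(2)}(k_1,\ldots,k_r)=c\,\zeta_{\mathcal{A}}^{(2)}(k),$$ where the sum is over all tuples of positive integers $(k_1,\ldots,k_r)$ satisfying the indicated conditions.
   Context: Let $\mathcal{A}=\left(\prod_{p}\mathbb{Z}/p\mathbb{Z}\right)/\left(\bigoplus_{p}\mathbb{Z}/p\mathbb{Z}\right)$, where $p$ runs over all prime numbers; it is a $\mathbb{Q}$-algebra. An element of $\mathcal{A}$ is represented by a family $(a_{(p)})_p$ with $a_{(p)}\in\mathbb{Z}/p\mathbb{Z}$, and two families represent the same element iff they agree for all but finitely many $p$. For positive integers $k_1,\ldots,k_r$, define $\zeta_{\mathcal{A}}^{(2)}(k_1,\ldots,k_r)\in\mathcal{A}$ by $$\zeta_{\mathcal{A}}^{(2)}(k_1,\ldots,k_r)_{(p)}=\sum_{0<m_1<\cdots<m_r<p/2}\frac{1}{m_1^{k_1}\cdots m_r^{k_r}}\bmod p.$$ An empty sum is $0$. *)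

(* Defs.v *)
From HB Require Import structures.
From mathcomp Require Import all_boot all_order all_algebra.
From mathcomp Require Import boolp classical_sets functions cardinality.
Set Implicit Arguments.
Unset Strict Implicit.
Unset Printing Implicit Defensive.
Import Order.TTheory GRing.Theory Num.Theory.
Local Open Scope classical_set_scope.
Local Open Scope ring_scope.

Definition prime_index := {p : nat | prime p}.

Definition residues : Type := forall p : prime_index, 'F_(val p).

HB.instance Definition _ := gen_eqMixin residues.
HB.instance Definition _ := gen_choiceMixin residues.

Section ResiduesRing.

Let zero : residues := fun=> 0.
Let one : residues := fun=> 1.
Let opp (x : residues) : residues := fun p => - x p.
Let add (x y : residues) : residues := fun p => x p + y p.
Let mul (x y : residues) : residues := fun p => x p * y p.

Let addA : associative add.
Proof. by move=> x y z; apply: functional_extensionality_dep => p; exact: addrA. Qed.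
Let addC : commutative add.
Proof. by move=> x y; apply: functional_extensionality_dep => p; exact: addrC. Qed.
Let add0 : left_id zero add.
Proof. by move=> x; apply: functional_extensionality_dep => p; exact: add0r. Qed.
Let addN : left_inverse zero opp add.
Proof. by move=> x; apply: functional_extensionality_dep => p; exact: addNr. Qed.
Let mulA : associative mul.
Proof. by move=> x y z; apply: functional_extensionality_dep => p; exact: mulrA. Qed.
Let mulC : commutative mul.
Proof. by move=> x y; apply: functional_extensionality_dep => p; exact: mulrC. Qed.
Let mul1 : left_id one mul.
Proof. by move=> x; apply: functional_extensionality_dep => p; exact: mul1r. Qed.
Let mulD : left_distributive mul add.
Proof. by move=> x y z; apply: functional_extensionality_dep => p; exact: mulrDl. Qed.
Let one_neq0 : one != zero.
Proof.
apply/eqP => /(congr1 (fun x : residues => x (exist _ 2%N isT))) /eqP.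
by rewrite (oner_eq0 'F_2).
Qed.

HB.instance Definition _ := GRing.isZmodule.Build residues addA addC add0 addN.
HB.instance Definition _ :=
  GRing.Zmodule_isComNzRing.Build residues mulA mulC mul1 mulD one_neq0.

End ResiduesRing.

Lemma residuesDE (x y : residues) p : (x + y) p = x p + y p. Proof. by []. Qed.
Lemma residuesNE (x : residues) p : (- x) p = - x p. Proof. by []. Qed.
Lemma residuesBE (x y : residues) p : (x - y) p = x p - y p. Proof. by []. Qed.
Lemma residuesME (x y : residues) p : (x * y) p = x p * y p. Proof. by []. Qed.

Definition direct_sum : {pred residues} :=
  [pred x | `[< finite_set [set p | x p != 0] >]].

Lemma infinite_primes : ~ finite_set [set: prime_index].
Proof.
move=> fT; have : finite_set (val @` [set: prime_index]) by exact: finite_image.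
move=> /finite_seqP [s sE].
have [q q_gt q_pr] := prime_above (\max_(x <- s) x).
have : (val @` [set: prime_index]) q by exists (exist _ q q_pr).
rewrite sE /= => qs; move: q_gt.
by rewrite ltnNge (@leq_bigmax_seq _ _ xpredT id q qs).
Qed.

Lemma direct_sum_idealr_closed : idealr_closed direct_sum.
Proof.
split.
- apply/asboolP; apply: (sub_finite_set (B := classical_sets.set0)) => //.
- apply/negP => /asboolP /sub_finite_set sub; apply: infinite_primes; apply: sub.
  by move=> p _.
move=> a x y /asboolP fx /asboolP fy; apply/asboolP.
apply: (@sub_finite_set _ _ ([set p | x p != 0] `|` [set p | y p != 0]));
  last by rewrite finite_setU.
move=> p /=; case: (eqVneq (x p) 0) => [x0|]; last by left.
case: (eqVneq (y p) 0) => [y0|]; last by right.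
by rewrite residuesDE residuesME x0 y0 mulr0 addr0 eqxx.
Qed.

HB.instance Definition _ :=
  isIdealr.Build residues direct_sum direct_sum_idealr_closed.

(* The Q-algebra (prod_p Z/p) / (sum_p Z/p). *)
Definition calA : Type := {ideal_quot direct_sum}.
HB.instance Definition _ := GRing.ComNzRing.on calA.

Definition classA (x : residues) : calA := (\pi_{ideal_quot direct_sum} x)%qT.

Lemma classA_eq (x y : residues) :
  classA x = classA y <-> finite_set [set p | x p != y p].
Proof.
have -> : [set p | x p != y p] = [set p | (x - y) p != 0].
  by apply/funext => p /=; rewrite residuesBE subr_eq0.
split=> [/eqP|fxy].
  by rewrite /classA -Quotient.idealrBE => /asboolP.
by apply/eqP; rewrite /classA -Quotient.idealrBE; apply/asboolP.
Qed.

Lemma classAD : {morph classA : x y / x + y}.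
Proof. exact: rmorphD. Qed.
Lemma classAM : {morph classA : x y / x * y}.
Proof. exact: rmorphM. Qed.
Lemma classA1 : classA 1 = 1.
Proof. exact: rmorph1. Qed.

(* [ratr c] in 'F_p is the reduction of c mod p as soon as p does not divide
   the denominator of c; the finitely many other p are irrelevant in calA. *)
Definition rat_residues (c : rat) : residues := fun p => ratr c.

Definition scaleA (c : rat) (x : calA) : calA := classA (rat_residues c) * x.

Lemma ratr_div (F : fieldType) (n d : int) :
  d%:~R != 0 :> F -> ratr (n%:Q / d%:Q) = n%:~R / d%:~R :> F.
Proof.
case: divqP => [_|e x _]; first by rewrite eqxx.
rewrite !intrM mulf_eq0 negb_or => /andP[eF dF].
by rewrite /ratr -mulf_div divff // mul1r.
Qed.

Lemma ratrD_denq (F : fieldType) (a b : rat) :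
    (denq a)%:~R != 0 :> F -> (denq b)%:~R != 0 :> F ->
  ratr (a + b) = ratr a + ratr b :> F.
Proof.
move=> aF bF; rewrite -{1}[a]divq_num_den -{1}[b]divq_num_den.
rewrite addf_div ?intr_eq0 ?denq_neq0 // -!intrM -intrD ratr_div.
  by rewrite intrD !intrM /ratr addf_div.
by rewrite intrM mulf_neq0.
Qed.

Lemma ratrM_denq (F : fieldType) (a b : rat) :
    (denq a)%:~R != 0 :> F -> (denq b)%:~R != 0 :> F ->
  ratr (a * b) = ratr a * ratr b :> F.
Proof.
move=> aF bF; rewrite -{1}[a]divq_num_den -{1}[b]divq_num_den.
rewrite mulf_div -!intrM ratr_div; first by rewrite !intrM /ratr mulf_div.
by rewrite intrM mulf_neq0.
Qed.

Lemma finite_intr_eq0 (d : int) :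
  d != 0 -> finite_set [set p : prime_index | d%:~R == 0 :> 'F_(val p)].
Proof.
move=> d0; have f : finite_set (val @^-1` `I_(`|d|%N.+1) : set prime_index).
  by apply: finite_preimage; [move=> ? ? _ _; exact: val_inj|exact: finite_II].
apply: sub_finite_set f => p /= /eqP dp0; rewrite ltnS dvdn_leq ?absz_gt0 //.
rewrite (dvdn_pcharf (pchar_Fp (valP p))); apply/eqP.
by case: d dp0 {d0} => n //; rewrite NegzE mulrNz => /eqP; rewrite oppr_eq0 => /eqP.
Qed.

Lemma classA_eq_denq (a b : rat) (x y : residues) :
    (forall p : prime_index, (denq a)%:~R != 0 :> 'F_(val p) ->
       (denq b)%:~R != 0 :> 'F_(val p) -> x p = y p) ->
  classA x = classA y.
Proof.
move=> xy; apply/classA_eq.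
have fa := finite_intr_eq0 (denq_neq0 a).
have fb := finite_intr_eq0 (denq_neq0 b).
have fab : finite_set ([set p : prime_index | (denq a)%:~R == 0 :> 'F_(val p)]
   `|` [set p : prime_index | (denq b)%:~R == 0 :> 'F_(val p)]).
  by rewrite finite_setU.
apply: sub_finite_set fab => p xyp.
case: (eqVneq ((denq a)%:~R : 'F_(val p)) 0) => [a0|a0]; first by left; apply/eqP.
case: (eqVneq ((denq b)%:~R : 'F_(val p)) 0) => [b0|b0]; first by right; apply/eqP.
by move: xyp; rewrite /mkset (xy p a0 b0) eqxx.
Qed.

Lemma rat_residuesD (a b : rat) :
  classA (rat_residues (a + b)) =
  classA (rat_residues a) + classA (rat_residues b).
Proof.
by rewrite -classAD; apply: (@classA_eq_denq a b) => p; exact: ratrD_denq.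
Qed.

Lemma rat_residuesM (a b : rat) :
  classA (rat_residues (a * b)) =
  classA (rat_residues a) * classA (rat_residues b).
Proof.
by rewrite -classAM; apply: (@classA_eq_denq a b) => p; exact: ratrM_denq.
Qed.

Lemma rat_residues1 : rat_residues 1 = 1.
Proof. by apply: functional_extensionality_dep => p; exact: (ratr_nat _ 1). Qed.

Fact scaleAA (a b : rat) (x : calA) : scaleA a (scaleA b x) = scaleA (a * b) x.
Proof. by rewrite /scaleA rat_residuesM mulrA. Qed.
Fact scale1A : left_id 1 scaleA.
Proof. by move=> x; rewrite /scaleA rat_residues1 classA1 mul1r. Qed.
Fact scaleADr : right_distributive scaleA +%R.
Proof. by move=> a x y; exact: mulrDr. Qed.
Fact scaleADl (x : calA) : {morph scaleA^~ x : a b / a + b}.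
Proof. by move=> a b; rewrite /scaleA rat_residuesD mulrDl. Qed.
HB.instance Definition _ :=
  GRing.Zmodule_isLmodule.Build rat calA scaleAA scale1A scaleADr scaleADl.

Fact scaleAAl (a : rat) (x y : calA) : a *: (x * y) = (a *: x) * y.
Proof. exact: mulrA. Qed.
HB.instance Definition _ := GRing.Lmodule_isLalgebra.Build rat calA scaleAAl.

Fact scaleAAr (a : rat) (x y : calA) : a *: (x * y) = x * (a *: y).
Proof. exact: mulrCA. Qed.
HB.instance Definition _ := GRing.Lalgebra_isAlgebra.Build rat calA scaleAAr.

Lemma scale_classA (c : rat) (x : residues) :
  c *: classA x = classA (fun p => ratr c * x p).
Proof. by rewrite [LHS]/GRing.scale /= /scaleA -classAM. Qed.

(* The index tuple k_1, ..., k_r is the function k : 'I_r -> nat, numbered from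
   0. Every m_j of a summand lies in [1, p/2), so letting the m_j range over
   'I_p loses nothing, and all denominators are units of 'F_p. *)
Definition zetaA2_residues (r : nat) (k : 'I_r -> nat) : residues :=
  fun p : prime_index =>
  \sum_(m : {ffun 'I_r -> 'I_(val p)} |
           [&& [forall j, 0 < m j], [forall j, (m j).*2 < val p] &
               [forall i : 'I_r, forall j : 'I_r, (i < j) ==> (m i < m j)]]%N)
     (\prod_(j < r) (m j)%:R ^+ k j)^-1.

Definition zetaA2 (r : nat) (k : 'I_r -> nat) : calA :=
  classA (zetaA2_residues k).

(* Main.v *)
Require Import Defs.
From mathcomp Require Import all_boot all_order all_algebra.
From mathcomp Require Import ring zify.
From mathcomp Require classical_sets cardinality.
Import GRing.Theory.
Local Open Scope ring_scope.
Set Implicit Arguments.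
Unset Strict Implicit.

(** Fix a prime p = 2n+1, large with respect to k. Everything takes place in
    the field F_p, where sums run over 0 < m_1 < ... < m_r <= n.

    Reduction to zeta({2}^a,1,{2}^b). Mark the exponents by a variable X. The
    even exponents at m contribute X^2/(m^2 - X^2), the odd ones
    mX/(m^2 - X^2). Mark also the m_j below the odd position by Y and those
    above it by Z. Then the sums of the theorem, for all r and i, are the
    coefficients of
      sum_m prod_(l<m) (1 - (1-Y) X^2/l^2) (X/m) prod_(l>m) (1 - (1-Z) X^2/l^2)
    divided by prod_(l<=n) (1 - X^2/l^2). In F_p this last product is
    1 - X^(p-1) ([prod_inv_sq]), because both sides are 1 at 0 and vanish at
    the nonzero residues, so the division has no effect on the coefficient of
    X^k.
    Expanding, the sum of the theorem is an integral combination, with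
    coefficients independent of p, of the coefficients of the two-variable
    polynomial
      G(u,v) = sum_m prod_(l<m) (1 - u/l^2) (1/m) prod_(l>m) (1 - v/l^2),
    which are the (-1)^(a+b) zeta({2}^a,1,{2}^b) with 2(a+b)+1 = k
    ([coef_chain_parity]).

    Evaluation of zeta({2}^a,1,{2}^b). Let 1 <= N, M <= n. In G(N^2,M^2) only
    the terms with M <= m <= N survive. If L = N - M is positive, they form an
    L-th finite difference of a polynomial of degree L; if N = M there is one
    term. Hence N G(N^2,M^2) is -(-1)^L, -1/2 or 0 according as N > M, N = M or
    N < M. In all cases this is
    -(h(N+M) + h(N-M))/2, where h is the odd function on F_p such that
    h(t) = (-1)^t for 0 < t < p. Writing every nonzero residue as 2m or -2m
    with 1 <= m <= n shows that h(t) = - sum_j 2^(1-j) zeta(j) t^j, over odd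
    j <= p-2 ([sign_polynomial]). So G and an explicit polynomial built from
    the zeta(j) agree at all pairs of nonzero squares; their degrees in u and
    in v are less than the number n of nonzero squares, so they are equal, and
    the coefficient of u^a v^b is C(k,2b) 2^(1-k) zeta(k) with k = 2(a+b)+1
    ([zeta_2_1_2E]).

    Altogether c = (-1)^(r-1) 2^(1-k) sum C(a,i) C(b,r-1-i) C(k,2b), over
    2(a+b)+1 = k and with i counted from 0. *)

(** * Sums over increasing tuples *)

Section ChainSum.

Variable S : comNzRingType.
Implicit Types (f : nat -> nat -> S) (A B : nat -> S).

(** The sum of f 0 m_0 ... f (r-1) m_(r-1) over 0 <= m_0 < ... < m_(r-1) < h,
    organised by the value of the last index so that it satisfies a Pascal type
    recursion in r and h. *)
Fixpoint chain_sum f (r h : nat) : S :=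
  if r is r'.+1 then \sum_(0 <= m < h) chain_sum f r' m * f r' m else 1.

Lemma chain_sumS f r h :
  chain_sum f r.+1 h.+1 = chain_sum f r.+1 h + chain_sum f r h * f r h.
Proof. by rewrite /= big_nat_recr. Qed.

Lemma eq_chain_sum f g r h :
    (forall j m, (j < r)%N -> f j m = g j m) ->
  chain_sum f r h = chain_sum g r h.
Proof.
elim: r h => //= r IHr h fg; apply: eq_bigr => m _.
by rewrite IHr ?fg // => j m' jr; rewrite fg // ltnW.
Qed.

Definition snoc_ffun N r (q : 'I_N * {ffun 'I_r -> 'I_N}) : {ffun 'I_r.+1 -> 'I_N} :=
  [ffun j => if unlift ord_max j is Some j' then q.2 j' else q.1].

Lemma snoc_ffun_max N r (q : 'I_N * {ffun 'I_r -> 'I_N}) :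
  snoc_ffun q ord_max = q.1.
Proof. by rewrite ffunE unlift_none. Qed.

Lemma snoc_ffun_lift N r (q : 'I_N * {ffun 'I_r -> 'I_N}) j :
  snoc_ffun q (lift ord_max j) = q.2 j.
Proof. by rewrite ffunE liftK. Qed.

Lemma snoc_ffun_bij N r : bijective (@snoc_ffun N r).
Proof.
exists (fun m : {ffun 'I_r.+1 -> 'I_N} =>
          (m ord_max, [ffun j => m (lift ord_max j)])) => [[x g]|m].
  by congr pair; [rewrite snoc_ffun_max | apply/ffunP => j; rewrite ffunE snoc_ffun_lift].
apply/ffunP => j; case: (unliftP ord_max j) => [j'|] ->.
  by rewrite snoc_ffun_lift ffunE.
by rewrite snoc_ffun_max.
Qed.

Definition increasing N r (m : {ffun 'I_r -> 'I_N}) :=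
  [forall i : 'I_r, forall j : 'I_r, (i < j)%N ==> (m i < m j)%N].

Lemma increasingP N r (m : {ffun 'I_r -> 'I_N}) :
  reflect (forall i j : 'I_r, (i < j)%N -> (m i < m j)%N) (increasing m).
Proof.
apply: (iffP forallP) => [inc i j ij|inc i].
  by move/forallP/(_ j)/implyP: (inc i) => ->.
by apply/forallP => j; apply/implyP; exact: inc.
Qed.

Lemma increasing_snoc N r (q : 'I_N * {ffun 'I_r -> 'I_N}) h :
  [forall j, snoc_ffun q j < h]%N && increasing (snoc_ffun q) =
  (q.1 < h)%N && ([forall j, q.2 j < q.1]%N && increasing q.2).
Proof.
apply/andP/and3P => [[/forallP bnd /increasingP inc]|[xh /forallP bnd /increasingP inc]].
  split.
  - by have := bnd ord_max; rewrite snoc_ffun_max.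
  - apply/forallP => j; have := inc (lift ord_max j) ord_max.
    by rewrite snoc_ffun_lift snoc_ffun_max lift_max; apply.
  - apply/increasingP => i j ij; have := inc (lift ord_max i) (lift ord_max j).
    by rewrite !snoc_ffun_lift !lift_max; apply.
split; first apply/forallP => j.
  case: (unliftP ord_max j) => [j'|] ->; last by rewrite snoc_ffun_max.
  by rewrite snoc_ffun_lift; apply: ltn_trans xh.
apply/increasingP => i j; case: (unliftP ord_max j) => [j'|] ->;
  case: (unliftP ord_max i) => [i'|] ->;
  rewrite ?snoc_ffun_lift ?snoc_ffun_max ?ltnn //.
- by rewrite !lift_max; exact: inc.
- by rewrite lift_max /= => ij; have := ltn_trans ij (ltn_ord j'); rewrite ltnn.
Qed.

(** An increasing tuple of length r+1 is its last entry x together with an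
    increasing tuple of length r with entries below x. *)
Lemma sum_increasing N f r h : (h <= N)%N ->
  \sum_(m : {ffun 'I_r -> 'I_N} | [forall j, m j < h]%N && increasing m)
     \prod_(j < r) f j (m j) = chain_sum f r h.
Proof.
elim: r h => [|r IHr] h hN /=.
  rewrite (big_pred1 (ffun0 (card_ord 0))) ?big_ord0 // => m.
  have -> : m = ffun0 (card_ord 0) by apply/ffunP => -[].
  rewrite /= eqxx; apply/andP; split; first by apply/forallP => -[].
  by apply/increasingP => -[].
rewrite (reindex _ (onW_bij _ (@snoc_ffun_bij N r))) /=.
rewrite big_mkord (big_ord_widen _ (fun m => chain_sum f r m * f r m) hN).
under [RHS]eq_bigr => x xh do rewrite -IHr ?big_distrl ?(ltnW (ltn_ord x)) //=.
rewrite pair_big_dep /=; apply: eq_big => [q|q _]; first exact: increasing_snoc.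
rewrite big_ord_recr /= snoc_ffun_max; congr (_ * _); apply: eq_bigr => j _.
rewrite -(snoc_ffun_lift q); congr (f _ (snoc_ffun _ _)); apply: val_inj.
by rewrite /= /bump leqNgt ltn_ord.
Qed.

(** With the same weight in every position the sum is an elementary symmetric
    function of the weights. *)
Lemma chain_sum_const A r h :
  chain_sum (fun=> A) r h = (\prod_(0 <= m < h) (1 + (A m)%:P * 'X))`_r.
Proof.
elim: h r => [|h IHh] [|r].
- by rewrite big_geq // coef1.
- by rewrite /= !big_geq // coef1.
- by rewrite big_nat_recr //= mulrDr mulr1 mulrCA coefD coefCM coefMX mulr0 addr0 -IHh.
- rewrite chain_sumS big_nat_recr //= mulrDr mulr1 mulrCA coefD coefCM coefMX /=.
  by rewrite -!IHh [A h * _]mulrC.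
Qed.

(** One position i carries the weight B; sort by the value m taken there. The
    i smaller indices are counted by the inner variable and the s larger ones by
    the outer variable. *)
Lemma chain_sum_mixed A B i s h :
  chain_sum (fun j => if j == i then B else A) (i + s).+1 h =
  (\sum_(0 <= m < h) (\prod_(0 <= l < m) (1 + 'X%:P * (A l)%:P%:P)) * (B m)%:P%:P
     * \prod_(m.+1 <= l < h) (1 + 'X * (A l)%:P%:P) : {poly {poly S}})`_s`_i.
Proof.
pose D h := \sum_(0 <= m < h) (\prod_(0 <= l < m) (1 + 'X%:P * (A l)%:P%:P)) *
  (B m)%:P%:P * \prod_(m.+1 <= l < h) (1 + 'X * (A l)%:P%:P) : {poly {poly S}}.
rewrite -/(D h).
have DS h' : D h'.+1 = D h' + 'X * ((A h')%:P%:P * D h') +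
    (\prod_(0 <= l < h') (1 + 'X%:P * (A l)%:P%:P)) * (B h')%:P%:P.
  rewrite /D big_nat_recr //= (big_geq (leqnn h'.+1)) mulr1; congr (_ + _).
  rewrite mulrA -[X in X + _]mul1r -mulrDl mulrC big_distrl /=.
  by apply: eq_big_nat => m /andP[_ mh]; rewrite big_nat_recr //= mulrA.
elim: h s => [|h IHh] s; first by rewrite /D /= !big_geq // !coef0.
rewrite chain_sumS IHh DS !coefD -addrA; congr (_ + _).
rewrite coefXM.
have -> : \prod_(0 <= l < h) (1 + 'X%:P * (A l)%:P%:P) =
          (\prod_(0 <= l < h) (1 + (A l)%:P * 'X))%:P :> {poly {poly S}}.
  rewrite rmorph_prod /=; apply: eq_bigr => l _.
  by rewrite rmorphD rmorphM /= mulrC rmorph1.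
rewrite -polyCM coefC; case: s => [|s] /=.
  rewrite coef0 add0r addn0 eqxx coefMC -chain_sum_const; congr (_ * _).
  by apply: eq_chain_sum => j m; rewrite ltn_neqAle => /andP[/negPf->].
by rewrite coef0 addr0 !coefCM addnS -IHh mulrC gtn_eqF // ltnS leq_addr.
Qed.

End ChainSum.

(** * Truncated power series *)

Section Congruence.

Variable W : comNzRingType.
Implicit Types t a b c d : W.

(** Congruence modulo a power of a variable stands in for an identity of power
    series, so that all computations remain in polynomial rings. *)
Definition eqmodr t a b := exists c, a = b + t * c.

Lemma eqmodr_refl t a : eqmodr t a a.
Proof. by exists 0; rewrite mulr0 addr0. Qed.

Lemma eqmodr_sym t a b : eqmodr t a b -> eqmodr t b a.
Proof. by move=> [c ->]; exists (- c); rewrite mulrN addrK. Qed.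

Lemma eqmodr_trans t b a c : eqmodr t a b -> eqmodr t b c -> eqmodr t a c.
Proof. by move=> [u ->] [v ->]; exists (v + u); rewrite mulrDr addrA. Qed.

Lemma eqmodrD t a b c d : eqmodr t a b -> eqmodr t c d -> eqmodr t (a + c) (b + d).
Proof. by move=> [u ->] [v ->]; exists (u + v); ring. Qed.

Lemma eqmodrM t a b c d : eqmodr t a b -> eqmodr t c d -> eqmodr t (a * c) (b * d).
Proof. by move=> [u ->] [v ->]; exists (u * d + b * v + t * u * v); ring. Qed.

Lemma eqmodr_sum t h (F G : nat -> W) :
    (forall m, (m < h)%N -> eqmodr t (F m) (G m)) ->
  eqmodr t (\sum_(0 <= m < h) F m) (\sum_(0 <= m < h) G m).
Proof.
elim: h => [|h IHh] FG; first by rewrite !big_geq //; exact: eqmodr_refl.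
rewrite !big_nat_recr //=; apply: eqmodrD (FG _ (ltnSn h)).
by apply: IHh => m mh; apply: FG; rewrite ltnW.
Qed.

Lemma eqmodr_prod t (r : seq nat) (F G : nat -> W) :
    (forall m, eqmodr t (F m) (G m)) ->
  eqmodr t (\prod_(m <- r) F m) (\prod_(m <- r) G m).
Proof.
move=> FG; elim/big_rec2: _ => [|m a b _]; first exact: eqmodr_refl.
exact: eqmodrM.
Qed.

End Congruence.

Lemma eqmodr_morph (S W : comNzRingType) (f : {rmorphism S -> W}) t a b :
  eqmodr t a b -> eqmodr (f t) (f a) (f b).
Proof. by move=> [c ->]; exists (f c); rewrite rmorphD rmorphM. Qed.

Lemma eqmodr_Xn (F : comNzRingType) (p q : {poly F}) t :
  (forall e, (e < t)%N -> p`_e = q`_e) -> eqmodr 'X^t p q.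
Proof.
move=> pq; exists (drop_poly t p - drop_poly t q).
rewrite -[q in q + _](poly_take_drop t) -[LHS](poly_take_drop t) mulrBr.
have -> : take_poly t p = take_poly t q.
  by apply/polyP => e; rewrite !coef_take_poly; case: ifP => // /pq.
by ring.
Qed.

(** The rational function identity behind the reduction: with
    A = xw/(1 - xw) and B = C/(1 - xw), multiplying by the product of all
    1 - xw, here congruent to 1, cancels every denominator, and
    (1 + yA)(1 - xw) = 1 - (1-y)xw. *)
Lemma clear_denominators (W : comNzRingType) (t x y z : W) (A B C w : nat -> W) h :
    (forall l, eqmodr t (A l * (1 - x * w l)) (x * w l)) ->
    (forall l, eqmodr t (B l * (1 - x * w l)) (C l)) ->
    eqmodr t (\prod_(0 <= l < h) (1 - x * w l)) 1 ->
  eqmodr t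
    (\sum_(0 <= m < h) (\prod_(0 <= l < m) (1 + y * A l)) * B m
       * \prod_(m.+1 <= l < h) (1 + z * A l))
    (\sum_(0 <= m < h) (\prod_(0 <= l < m) (1 - (1 - y) * x * w l)) * C m
       * \prod_(m.+1 <= l < h) (1 - (1 - z) * x * w l)).
Proof.
move=> hA hB h1.
have fac v l : eqmodr t ((1 + v * A l) * (1 - x * w l)) (1 - (1 - v) * x * w l).
  have -> : (1 + v * A l) * (1 - x * w l) =
            (1 - x * w l) + v * (A l * (1 - x * w l)) by ring.
  have -> : 1 - (1 - v) * x * w l = (1 - x * w l) + v * (x * w l) by ring.
  by apply: eqmodrD (eqmodr_refl _ _) (eqmodrM (eqmodr_refl _ _) (hA l)).
have hprod v r : eqmodr t
    ((\prod_(l <- r) (1 + v * A l)) * \prod_(l <- r) (1 - x * w l))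
    (\prod_(l <- r) (1 - (1 - v) * x * w l)).
  by rewrite -big_split /=; apply: eqmodr_prod => l; exact: fac.
apply: eqmodr_trans (_ : eqmodr t _ (_ * \prod_(0 <= l < h) (1 - x * w l))) _.
  by apply: eqmodr_sym; rewrite -[X in eqmodr _ _ X]mulr1;
     apply: eqmodrM (eqmodr_refl _ _) h1.
rewrite big_distrl /=; apply: eqmodr_sum => m mh.
rewrite (big_cat_nat (leq0n m) (ltnW mh)) /= (big_ltn mh).
set P := (\prod_(0 <= l < m) (1 + _)); set Q := (\prod_(m.+1 <= l < h) (1 + _)).
set P' := (\prod_(0 <= l < m) (1 - x * _)).
set Q' := (\prod_(m.+1 <= l < h) (1 - x * _)).
have -> : P * B m * Q * (P' * ((1 - x * w m) * Q')) =
          (P * P') * (B m * (1 - x * w m)) * (Q * Q') by ring.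
by apply: eqmodrM; [apply: eqmodrM; [exact: hprod|exact: hB]|exact: hprod].
Qed.

Section Truncation.
Variables (F : fieldType) (k : nat).

Definition even_series (w : F) : {poly F} :=
  \poly_(e < k.+1) (if (0 < e)%N && ~~ odd e then w ^+ e else 0).
Definition odd_series (w : F) : {poly F} :=
  \poly_(e < k.+1) (if odd e then w ^+ e else 0).

(** With w = 1/m these two congruences are the geometric series for
    X^2/(m^2 - X^2) and mX/(m^2 - X^2). *)
Lemma even_seriesE w :
  eqmodr 'X^(k.+1) (even_series w * (1 - 'X^2 * (w ^+ 2)%:P)) ('X^2 * (w ^+ 2)%:P).
Proof.
apply: eqmodr_Xn => e ek.
rewrite mulrBr mulr1 mulrCA coefB [X in _ - X]coefXnM [RHS]coefXnM.
rewrite coefMC !coef_poly ek coefC.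
case: e ek => [|[|e]] ek /=; rewrite ?subrr // subn2 /=.
rewrite (ltnW (ltnW ek)) negbK.
case: e ek => [|e] ek /=; first by rewrite mul0r subr0.
by case: ifP => _; rewrite ?mul0r ?subrr // -exprD addn2 subrr.
Qed.

Lemma odd_seriesE w :
  eqmodr 'X^(k.+1) (odd_series w * (1 - 'X^2 * (w ^+ 2)%:P)) ('X * w%:P).
Proof.
apply: eqmodr_Xn => e ek.
rewrite mulrBr mulr1 mulrCA coefB [X in _ - X]coefXnM [RHS]coefXM.
rewrite coefMC !coef_poly ek coefC.
case: e ek => [|[|e]] ek /=; rewrite ?subr0 // subn2 /=.
rewrite (ltnW (ltnW ek)) negbK.
by case: ifP => _; rewrite ?mul0r ?subrr // -exprD addn2 subrr.
Qed.

End Truncation.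

(** * Arithmetic modulo an odd prime *)

Definition inv_sq {F : fieldType} (l : nat) : F := (l%:R^-1) ^+ 2.

Section CharP.

Variables (F : fieldType) (n : nat).
Let p := n.*2.+1.

Lemma size_prod_linear (r : seq nat) (w : nat -> F) :
  (size (\prod_(l <- r) (1 - 'X * (w l)%:P))%R <= (size r).+1)%N.
Proof.
elim: r => [|l r IHr]; first by rewrite big_nil size_poly1.
rewrite big_cons (leq_trans (size_polyMleq _ _)) //.
have : (size (1 - 'X * (w l)%:P)%R <= 2)%N.
  rewrite (leq_trans (size_polyD _ _)) // size_poly1 size_polyN geq_max /=.
  by rewrite mulrC mul_polyC (leq_trans (size_scale_leq _ _)) ?size_polyX.
by move=> /leq_add/(_ IHr); rewrite /=; case: (_ + _)%N.
Qed.

Definition squares : seq F := [seq m%:R ^+ 2 | m <- index_iota 1 n.+1].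

Lemma size_squares : size squares = n.
Proof. by rewrite size_map size_iota subn1. Qed.

Hypothesis charF : p \in [pchar F].

Lemma natr_eq0_pchar m : (m%:R == 0 :> F) = (p %| m)%N.
Proof. by rewrite (dvdn_pcharf charF). Qed.

Lemma natr_neq0 m : (0 < m < p)%N -> m%:R != 0 :> F.
Proof. by case/andP=> m0 mp; rewrite natr_eq0_pchar gtnNdvd. Qed.

Lemma natr_eq_small a b : (a < p)%N -> (b < p)%N -> (a%:R == b%:R :> F) = (a == b).
Proof.
wlog le_ab : a b / (b <= a)%N => [hw|] ap bp.
  by case: (leqP b a) => [/hw->//|/ltnW/hw h]; rewrite eq_sym h // eq_sym.
rewrite -subr_eq0 -natrB // natr_eq0_pchar.
case: (posnP (a - b)) => [ab0|ab0]; first by rewrite ab0 dvdn0; lia.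
by rewrite gtnNdvd //; lia.
Qed.

Lemma n_gt0 : (0 < n)%N.
Proof.
by have /andP[/prime_gt1 + _] := charF; rewrite /p ltnS double_gt0.
Qed.

Lemma two_n : n%:R * 2 = -1 :> F.
Proof.
apply/eqP; rewrite -subr_eq0 opprK -natrM -(natrD _ _ 1) natr_eq0_pchar.
by rewrite muln2 addn1.
Qed.

Lemma two_neq0 : 2 != 0 :> F.
Proof. have n0 := n_gt0; apply: natr_neq0; rewrite /p; lia. Qed.

Lemma fermat m : (0 < m < p)%N -> m%:R ^+ n.*2 = 1 :> F.
Proof.
move=> /natr_neq0 m0; apply: (mulfI m0); rewrite -exprS mulr1.
by rewrite -[LHS](pFrobenius_autE charF) pFrobenius_aut_nat.
Qed.

Lemma uniq_squares : uniq squares.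
Proof.
rewrite map_inj_in_uniq ?iota_uniq // => a b; rewrite !mem_index_iota => ha hb.
move=> /eqP; rewrite eqf_sqr => /orP[|].
  by rewrite natr_eq_small; [move/eqP|rewrite /p; lia..].
rewrite -addr_eq0 -natrD natr_eq0_pchar gtnNdvd //; rewrite /p; lia.
Qed.

Lemma poly_squares_eq0 (q : {poly F}) :
  (size q <= n)%N -> (forall x, x \in squares -> q.[x] = 0) -> q = 0.
Proof.
move=> sq q0; apply: (@roots_geq_poly_eq0 _ _ squares).
- by apply/allP => x /q0/eqP.
- by rewrite uniq_squares.
- by rewrite size_squares.
Qed.

(** Both sides take the value 1 at 0 and vanish at the n nonzero squares, and
    their degrees are at most n. *)
Lemma prod_inv_sq :
  \prod_(1 <= l < n.+1) (1 - 'X * (inv_sq l)%:P) = 1 - 'X^n :> {poly F}.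
Proof.
apply/eqP; rewrite -subr_eq0; apply/eqP.
set D := _ - _.
apply: (@roots_geq_poly_eq0 _ _ (0 :: squares)).
- apply/allP => x; rewrite inE => /predU1P[->|].
    rewrite /D /root !hornerE horner_prod big1 => [|l _]; last by rewrite !hornerE /= subr0.
    by rewrite expr0n (gtn_eqF n_gt0) /= subr0 subrr.
  case/mapP=> m; rewrite mem_index_iota => mn ->.
  rewrite /D /root !hornerE horner_prod (bigD1_seq m) ?mem_index_iota ?iota_uniq //=.
  have m0 : m%:R != 0 :> F by apply: natr_neq0; rewrite /p; lia.
  rewrite !hornerE /= /inv_sq -[_ / _ / _]mulrA -invfM -expr2.
  rewrite divff ?expf_neq0 // subrr mul0r.
  by rewrite -exprM mul2n fermat ?subrr //; rewrite /p; lia.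
- rewrite /= uniq_squares andbT; apply/mapP=> -[m]; rewrite mem_index_iota => mn /esym/eqP.
  by rewrite expf_eq0 /=; apply/negP/natr_neq0; rewrite /p; lia.
- rewrite /= size_squares (leq_trans (size_polyD _ _)) // geq_max.
  rewrite (leq_trans (size_prod_linear _ _)) ?size_iota ?subn1 //=.
  rewrite size_polyN (leq_trans (size_polyD _ _)) // geq_max size_poly1.
  by rewrite size_polyN size_polyXn leqnn.
Qed.

End CharP.

(** * The generating function at pairs of squares *)

(** The L-th finite difference kills polynomials of degree less than L and
    sends a monic polynomial of degree L to L! up to sign. Here the polynomial
    is given by its linear factors, and one factor i + c is removed at a time:
    the part c lowers the degree, while i C(L,i) = L C(L-1,i-1) lowers L. *)
Lemma alternating_binomial_prod (R : comNzRingType) L (cs : seq R) :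
    (size cs <= L)%N ->
  \sum_(0 <= i < L.+1) (-1) ^+ i * 'C(L, i)%:R * \prod_(c <- cs) (i%:R + c) =
  ((-1) ^+ L * L`!%:R) *+ (size cs == L).
Proof.
have [d] := ubnP (size cs); elim: d cs L => // d IHd [|c cs] L /= csd.
  case: L => [|L] _; first by rewrite big_nat1 big_nil !mulr1.
  transitivity ((1 - 1 : R) ^+ L.+1); last by rewrite subrr expr0n.
  rewrite exprDn big_mkord; apply: eq_bigr => i _.
  by rewrite big_nil mulr1 expr1n mul1r mulr_natr.
case: L => // L csL.
under eq_bigr => i _ do rewrite big_cons mulrDl mulrDr.
rewrite big_split /= [X in _ + X](_ : _ = 0) ?addr0; last first.
  rewrite [LHS](_ : _ = c * \sum_(0 <= i < L.+2)
      (-1) ^+ i * 'C(L.+1, i)%:R * \prod_(c <- cs) (i%:R + c)).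
    by rewrite IHd ?(ltn_eqF csL) ?mulr0 // ltnW.
  by rewrite big_distrr; apply: eq_bigr => i _ /=; ring.
rewrite big_nat_recl // mul0r mulr0 add0r eqSS.
transitivity (- L.+1%:R * \sum_(0 <= i < L.+1) (-1) ^+ i * 'C(L, i)%:R *
    \prod_(c <- [seq 1 + d | d <- cs]) (i%:R + c)); last first.
  rewrite IHd ?size_map // mulrnAr factS natrM exprS; congr (_ *+ _); ring.
rewrite big_distrr; apply: eq_bigr => i _ /=; rewrite big_map.
under [in RHS]eq_bigr => c' _ do rewrite addrA natr1.
have := mul_bin_diag L.+1 i => /(congr1 (fun x => x%:R : R)); rewrite /= !natrM => E.
rewrite exprS; set P := \prod_(_ <- _) _.
transitivity (- (-1) ^+ i * (i.+1%:R * 'C(L.+1, i.+1)%:R) * P); first by ring.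
by rewrite -E; ring.
Qed.

Section FactorialEvaluations.

Variables (F : fieldType) (n : nat).
Let p := n.*2.+1.
Hypothesis charF : p \in [pchar F].

Notation fct m := (m`!%:R : F).

Lemma fact_neq0 m : (m < p)%N -> fct m != 0.
Proof.
elim: m => [|m IHm] mp; first exact: oner_neq0.
by rewrite factS natrM mulf_neq0 ?IHm ?(ltnW mp) // (natr_neq0 charF).
Qed.

Lemma inv_sqK l (x : F) : (0 < l < p)%N -> (1 - x * inv_sq l) * l%:R ^+ 2 = l%:R ^+ 2 - x.
Proof. by move=> /(natr_neq0 charF) l0; rewrite /inv_sq; field. Qed.

(** The product is the Pochhammer quotient (1-N)_j (1+N)_j / j!^2, written here
    without division. *)
Lemma left_prodE N j : (j < N <= n)%N ->
  N%:R * \prod_(1 <= l < j.+1) (1 - N%:R ^+ 2 * inv_sq l) * fct j ^+ 2 * fct (N - j.+1)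
  = (-1) ^+ j * fct (N + j).
Proof.
elim: j => [|j IHj] jN.
  rewrite big_geq // fact0 expr1n !mulr1 mul1r addn0 subn1 -natrM.
  by case: (N) jN => // N' _; rewrite factS.
have {}IHj := IHj ltac:(lia).
have Nj : (N - j.+1 = (N - j.+2).+1)%N by lia.
rewrite Nj factS natrM in IHj.
rewrite addnS !factS [in RHS]exprS !natrM mulN1r big_nat_recr //=.
have := @inv_sqK j.+1 (N%:R ^+ 2) ltac:(rewrite /p; lia) => E.
have hN : (N - j.+2).+1%:R = N%:R - j.+1%:R :> F by rewrite -natrB; [congr (_%:R); lia|lia].
have hNj : (N + j).+1%:R = N%:R + j.+1%:R :> F by rewrite -natrD addnS.
rewrite hN in IHj; rewrite hNj.
set P := \prod_(1 <= l < j.+1) _ in IHj *.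
transitivity (N%:R * P * ((1 - N%:R ^+ 2 * inv_sq j.+1) * j.+1%:R ^+ 2) * fct j ^+ 2
    * fct (N - j.+2)); first by ring.
rewrite E; transitivity (- (N%:R + j.+1%:R) * (N%:R * P * fct j ^+ 2 *
    ((N%:R - j.+1%:R) * fct (N - j.+2)))); first by ring.
by rewrite IHj; ring.
Qed.

Lemma left_prod0 N m : (0 < N < m)%N -> (N <= n)%N ->
  \prod_(1 <= l < m) (1 - N%:R ^+ 2 * inv_sq l) = 0 :> F.
Proof.
move=> Nm Nn; rewrite (bigD1_seq N) ?mem_index_iota ?iota_uniq //=.
have N0 : N%:R != 0 :> F by apply: (natr_neq0 charF); rewrite /p; lia.
by rewrite /inv_sq -exprMn divff // expr1n subrr mul0r.
Qed.

Lemma right_prod0 M m : (m < M <= n)%N ->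
  \prod_(m.+1 <= l < n.+1) (1 - M%:R ^+ 2 * inv_sq l) = 0 :> F.
Proof.
move=> Mm; rewrite (bigD1_seq M) ?mem_index_iota ?iota_uniq //=.
have N0 : M%:R != 0 :> F by apply: (natr_neq0 charF); rewrite /p; lia.
by rewrite /inv_sq -exprMn divff // expr1n subrr mul0r.
Qed.

(** This is where the characteristic enters: n+1+M = -(n-M) as 2n+1 = 0. *)
Lemma fact_reflection M : (M <= n)%N ->
  fct (n - M) * fct (n + M) = (-1) ^+ M * fct n ^+ 2.
Proof.
elim: M => [|M IHM] Mn; first by rewrite subn0 addn0 mul1r expr2.
rewrite exprS -mulrA -IHM ?(ltnW Mn) // addnS factS.
rewrite (_ : n - M = (n - M.+1).+1)%N; last by lia.
rewrite factS !natrM (_ : (n + M).+1%:R = - (n - M.+1).+1%:R :> F); first by ring.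
apply/eqP; rewrite -addr_eq0 -natrD (natr_eq0_pchar charF); apply/eqP.
rewrite (_ : (n + M).+1 + (n - M.+1).+1 = p)%N ?modnn // /p; lia.
Qed.

(** Descending induction on m, starting from [fact_reflection] at m = n, where
    the product is empty. *)
Lemma right_prodE M m : (0 < M)%N -> (M <= m <= n)%N ->
  \prod_(m.+1 <= l < n.+1) (1 - M%:R ^+ 2 * inv_sq l) * fct (m - M) * fct (m + M)
  = (-1) ^+ M * fct m ^+ 2.
Proof.
move=> M0; have [d] := ubnP (n - m); elim: d m => // d IHd m dm Mm.
case: (eqVneq m n) => [->|mn].
  by rewrite big_geq // mul1r fact_reflection //; lia.
have m1 : m.+1%:R ^+ 2 != 0 :> F.
  by rewrite expf_neq0 // (natr_neq0 charF) // /p; lia.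
apply: (mulIf m1).
have mltn : (m.+1 < n.+1)%N by lia.
have := IHd m.+1 ltac:(lia) ltac:(lia).
rewrite (big_ltn mltn) subSn ?addSn; last by lia.
rewrite !factS !natrM => IHm.
have := @inv_sqK m.+1 (M%:R ^+ 2) ltac:(rewrite /p; lia) => E.
have hN : (m - M).+1%:R = m.+1%:R - M%:R :> F by rewrite -natrB; [congr (_%:R); lia|lia].
have hNj : (m + M).+1%:R = m.+1%:R + M%:R :> F by rewrite -natrD addSn.
rewrite hN hNj in IHm.
set P := \prod_(m.+2 <= l < _) _ in IHm *.
transitivity (((1 - M%:R ^+ 2 * inv_sq m.+1) * m.+1%:R ^+ 2) * P * fct (m - M)
    * fct (m + M)); first by ring.
rewrite E; transitivity ((-1) ^+ M * (m.+1%:R * fct m) ^+ 2); last by ring.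
by rewrite -IHm; ring.
Qed.
End FactorialEvaluations.

Section GeneratingFunction.

Variables (F : fieldType) (n : nat).
Let p := n.*2.+1.
Hypothesis charF : p \in [pchar F].

Notation fct m := (m`!%:R : F).

(** Its coefficients are the zeta({2}^a,1,{2}^b) up to sign; see
    [gen_fun_expand]. *)
Definition gen_fun (u v : F) : F :=
  \sum_(1 <= m < n.+1) (\prod_(1 <= l < m) (1 - u * inv_sq l)) * m%:R^-1
    * \prod_(m.+1 <= l < n.+1) (1 - v * inv_sq l).

Lemma fact_rising a s : fct (a + s) = fct a * \prod_(j <- iota 1 s) (a%:R + j%:R).
Proof.
elim: s => [|s IHs]; first by rewrite addn0 big_nil mulr1.
rewrite addnS factS natrM IHs -[s.+1]addn1 iotaD big_cat big_seq1 /= add1n.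
by rewrite -natrD addnS; ring.
Qed.

(** The factorials of [left_prodE] and [right_prodE] combine into a binomial
    coefficient and the ratio of (N+m-1)! to (m+M)!, where m = i + M, which is
    polynomial in i when N > M. *)
Lemma gen_fun_termE N M i : (0 < M)%N -> (i + M <= N <= n)%N ->
  N%:R * ((\prod_(1 <= l < i + M) (1 - N%:R ^+ 2 * inv_sq l)) * (i + M)%:R^-1
    * \prod_((i + M).+1 <= l < n.+1) (1 - M%:R ^+ 2 * inv_sq l))
    * (fct (N - M) * fct (i + M + M)) =
  - ((-1) ^+ i * 'C(N - M, i)%:R * (i + M)%:R * fct (N + (i + M).-1)).
Proof.
move=> M0 iN.
have := @right_prodE _ _ charF M (i + M) M0 ltac:(lia).
have := @left_prodE _ _ charF N (i + M).-1 ltac:(lia).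
rewrite (_ : (i + M).-1.+1 = i + M)%N; last by lia.
rewrite addnK.
set P := \prod_(1 <= l < _) _; set B := \prod_(_.+1 <= l < _) _ => hP hB.
have hf : fct (i + M) = (i + M)%:R * fct (i + M).-1.
  by rewrite -natrM -[in LHS](@prednK (i + M)) ?factS ?prednK //; lia.
have hb : fct (N - M) = 'C(N - M, i)%:R * (fct i * fct (N - (i + M))).
  by rewrite -!natrM [in (N - (i + M))%N]addnC subnDA bin_fact //; lia.
have m0 : (i + M)%:R != 0 :> F by apply: (natr_neq0 charF); rewrite /p; lia.
have f0 : fct (i + M).-1 != 0 by apply: (fact_neq0 charF); rewrite /p; lia.
have sgn : (-1) ^+ (i + M).-1 * (-1) ^+ M = - (-1) ^+ i :> F.
  rewrite -exprD -[RHS]mulN1r -exprS -[LHS]signr_odd -[RHS]signr_odd.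
  by congr (_ ^+ _); lia.
rewrite hf in hB; rewrite hb.
apply: (mulIf (expf_neq0 2 f0)).
transitivity ('C(N - M, i)%:R * (i + M)%:R^-1
  * (N%:R * P * fct (i + M).-1 ^+ 2 * fct (N - (i + M)))
  * (B * fct i * fct (i + M + M))); first by ring.
rewrite hP hB.
transitivity ('C(N - M, i)%:R * fct (N + (i + M).-1) * fct (i + M).-1 ^+ 2 *
  ((i + M)%:R^-1 * (i + M)%:R ^+ 2) * ((-1) ^+ (i + M).-1 * (-1) ^+ M)); first by ring.
by rewrite sgn expr2 mulKf //; ring.
Qed.

Lemma gen_fun_range N M : (0 < M <= N)%N -> (N <= n)%N ->
  gen_fun (N%:R ^+ 2) (M%:R ^+ 2) =
  \sum_(0 <= i < (N - M).+1)
   (\prod_(1 <= l < i + M) (1 - N%:R ^+ 2 * inv_sq l)) * (i + M)%:R^-1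
    * \prod_((i + M).+1 <= l < n.+1) (1 - M%:R ^+ 2 * inv_sq l).
Proof.
move=> MN Nn; rewrite /gen_fun.
have h1 : (1 <= N.+1)%N by [].
have h2 : (N.+1 <= n.+1)%N by [].
rewrite (big_cat_nat h1 h2) /= [X in _ + X]big1_seq ?addr0; last first.
  move=> m /=; rewrite mem_index_iota => hm.
  by rewrite (left_prod0 charF) ?mul0r //; lia.
have h3 : (1 <= M)%N by lia.
have h4 : (M <= N.+1)%N by lia.
rewrite (big_cat_nat h3 h4) /= [X in X + _]big1_seq ?add0r; last first.
  move=> m /=; rewrite mem_index_iota => hm.
  by rewrite (right_prod0 charF) ?mulr0 //; lia.
rewrite -{1}[M]add0n big_addn subSn //; lia.
Qed.

Lemma gen_fun_lt N M : (0 < N < M)%N -> (M <= n)%N ->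
  gen_fun (N%:R ^+ 2) (M%:R ^+ 2) = 0.
Proof.
move=> NM Mn; rewrite /gen_fun big1_seq // => m /=; rewrite mem_index_iota => hm.
case: (leqP m N) => mN; first by rewrite (right_prod0 charF) ?mulr0 //; lia.
by rewrite (left_prod0 charF) ?mul0r //; lia.
Qed.

Lemma gen_fun_diag N : (0 < N <= n)%N ->
  2 * (N%:R * gen_fun (N%:R ^+ 2) (N%:R ^+ 2)) = -1.
Proof.
move=> Nn; rewrite gen_fun_range ?subnn ?big_nat1; [|lia..].
have := @gen_fun_termE N N 0 ltac:(lia) ltac:(lia).
rewrite subnn add0n mul1r bin0 mul1r (_ : N + N = (N + N.-1).+1)%N; last by lia.
rewrite [(N + N.-1).+1`!]factS natrM (_ : (N + N.-1).+1%:R = N%:R * 2 :> F); last first.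
  by rewrite -natrM; congr (_%:R); lia.
have f0 : fct (N + N.-1) != 0 by apply: (fact_neq0 charF); rewrite /p; lia.
have N0 : N%:R != 0 :> F by apply: (natr_neq0 charF); rewrite /p; lia.
rewrite mul1r => E.
apply: (mulIf N0); apply: (mulIf f0).
by rewrite mulN1r mulNr -E; ring.
Qed.

(** The terms form the alternating binomial sum of
    (i + M) (i + 2M + 1) ... (i + 2M + L - 1), which has degree L = N - M. *)
Lemma gen_fun_gt N M : (0 < M < N)%N -> (N <= n)%N ->
  N%:R * gen_fun (N%:R ^+ 2) (M%:R ^+ 2) = - (-1) ^+ (N - M).
Proof.
move=> MN Nn; rewrite gen_fun_range //; last by lia.
have f0 : fct (N - M) != 0 by apply: (fact_neq0 charF); rewrite /p; lia.
apply: (mulIf f0).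
pose cs := M%:R :: [seq (M + M)%:R + j%:R | j <- iota 1 (N - M).-1] : seq F.
have scs : size cs = (N - M)%N by rewrite /= size_map size_iota; lia.
have := @alternating_binomial_prod F (N - M) cs.
rewrite scs eqxx leqnn => /(_ isT) /=; rewrite mulr1n => E.
rewrite mulNr -E big_distrr big_distrl /= -sumrN; apply: eq_big_nat => i iN.
have g0 : fct (i + M + M) != 0 by apply: (fact_neq0 charF); rewrite /p; lia.
apply: (mulIf g0); rewrite -mulrA gen_fun_termE; [|lia..].
rewrite big_cons big_map (_ : N + (i + M).-1 = i + M + M + (N - M).-1)%N; last by lia.
rewrite fact_rising natrD.
under [in RHS]eq_bigr => j _ do rewrite addrA -natrD addnA.
by ring.
Qed.

(** Equal to 2^(-2d) zeta(2d+1), and minus the coefficient of t^(2d+1) in the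
    polynomial that interpolates the parity sign; see [sign_polynomial]. *)
Definition sign_coef d : F := 2 * \sum_(1 <= m < n.+1) ((2 * m%:R)^-1) ^+ d.*2.+1.

Lemma odd_geometric (w : F) : w ^+ n.*2 = 1 ->
  2 * (\sum_(d < n) w ^+ d.*2.+1) = - w *+ (w ^+ 2 == 1).
Proof.
move=> wn; have [w1|w1] := eqVneq (w ^+ 2) 1.
  under eq_bigr => d _ do rewrite exprS -mul2n exprM w1 expr1n mulr1.
  by rewrite sumr_const card_ord -[w *+ n]mulr_natr mulrCA [2 * _]mulrC two_n // mulrN1.
have w2 : w ^+ 2 - 1 != 0 by rewrite subr_eq0.
apply: (mulfI w2); rewrite mulr0n mulr0.
under eq_bigr => d _ do rewrite exprS -mul2n exprM.
rewrite -mulr_sumr.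
transitivity (2 * w * ((w ^+ 2 - 1) * \sum_(d < n) (w ^+ 2) ^+ d)); first by ring.
by rewrite -subrX1 -exprM mul2n wn subrr mulr0.
Qed.

(** Summing over d first, a geometric sum detects t = 2m or t = -2m in F_p,
    that is t = 2m or t = p - 2m as integers. Exactly one m does this, with the
    first alternative when t is even and the second when t is odd. *)
Lemma sign_polynomial t : (0 < t < p)%N ->
  \sum_(d < n) sign_coef d * t%:R ^+ d.*2.+1 = - (-1) ^+ t.
Proof.
move=> tp.
have t0 := natr_neq0 charF tp.
pose w m : F := t%:R / (2 * m%:R).
transitivity (\sum_(1 <= m < n.+1) 2 * \sum_(d < n) w m ^+ d.*2.+1).
  rewrite -mulr_sumr exchange_big /= mulr_sumr; apply: eq_bigr => d _.
  rewrite /sign_coef -mulrA mulr_suml; congr (_ * _); apply: eq_bigr => m _.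
  by rewrite /w exprMn mulrC.
have m20 m : (1 <= m < n.+1)%N -> 2 * m%:R != 0 :> F.
  by move=> hm; rewrite mulf_neq0 ?(two_neq0 charF) // (natr_neq0 charF) // /p; lia.
have wE m : (1 <= m < n.+1)%N -> 2 * (\sum_(d < n) w m ^+ d.*2.+1) =
    - (m.*2 == t)%:R + (m.*2 + t == p)%N%:R.
  move=> hm; rewrite odd_geometric; last first.
    rewrite /w expr_div_n (fermat charF tp) -natrM mul2n (fermat charF) ?divr1 //.
    by rewrite /p; lia.
  have w1 : (w m == 1) = (m.*2 == t).
    rewrite /w -subr_eq0 -(mulIr_eq0 _ (mulIf (m20 m hm))) mulrBl divfK ?m20 // mul1r.
    by rewrite subr_eq0 eq_sym -natrM mul2n (natr_eq_small charF) //; rewrite /p; lia.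
  have w2 : (w m == -1) = (m.*2 + t == p)%N.
    rewrite /w -subr_eq0 -(mulIr_eq0 _ (mulIf (m20 m hm))) mulrBl divfK ?m20 // mulN1r.
    rewrite opprK -natrM mul2n -natrD (natr_eq0_pchar charF) [(t + _)%N]addnC.
    apply/idP/eqP => [|->]; last exact: dvdnn.
    by case/dvdnP => -[|[|q]] hq; move: hq tp hm; rewrite /p; lia.
  rewrite sqrf_eq1 w1 w2; case: eqP => [mt|mt]; case: eqP => [mp|mp] //=.
  - by exfalso; move: mp; rewrite /p; lia.
  - by rewrite (eqP (_ : w m == 1)) ?w1 ?mt ?eqxx // addr0.
  - by rewrite (eqP (_ : w m == -1)) ?w2 ?mp ?eqxx // opprK oppr0 add0r.
  - by rewrite oppr0 addr0.
rewrite (eq_big_nat _ _ wE) big_split /= sumrN.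
have delta (r : nat) (P : pred nat) : (1 <= r < n.+1)%N ->
    (forall m, (1 <= m < n.+1)%N -> P m = (m == r)) ->
    \sum_(1 <= m < n.+1) (P m)%:R = 1 :> F.
  move=> hr hP; rewrite (bigD1_seq r) ?mem_index_iota ?iota_uniq //= hP // eqxx.
  rewrite big1_seq ?addr0 // => m /andP[mr]; rewrite mem_index_iota => hm.
  by rewrite hP // (negPf mr).
have nodelta (P : pred nat) : (forall m, (1 <= m < n.+1)%N -> P m = false) ->
    \sum_(1 <= m < n.+1) (P m)%:R = 0 :> F.
  by move=> hP; rewrite big1_seq // => m /=; rewrite mem_index_iota => /hP ->.
rewrite -signr_odd; case: (boolP (odd t)) => ot.
  rewrite nodelta => [|m hm]; last by lia.
  rewrite (delta ((p - t)./2)); first by rewrite oppr0 add0r opprK.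
    by move: tp; rewrite /p; lia.
  by move=> m hm; move: tp; rewrite /p; lia.
rewrite (delta t./2); last 2 first.
- by move: tp; rewrite /p; lia.
- by move=> m hm; move: tp; rewrite /p; lia.
by rewrite nodelta ?addr0 // => m hm; rewrite /p; lia.
Qed.

End GeneratingFunction.

(** * Evaluation of zeta({2}^a,1,{2}^b) *)

Lemma odd_binomial (R : comNzRingType) (x y : R) d :
  (x + y) ^+ d.*2.+1 + (x - y) ^+ d.*2.+1 =
  2 * \sum_(0 <= b < d.+1) 'C(d.*2.+1, b.*2)%:R * x ^+ (d - b).*2.+1 * y ^+ b.*2.
Proof.
have pairs h (f : nat -> R) :
    \sum_(0 <= i < h.*2) f i = \sum_(0 <= b < h) (f b.*2 + f b.*2.+1).
  elim: h => [|h IHh]; first by rewrite !big_geq.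
  by rewrite doubleS !big_nat_recr //= IHh addrA.
rewrite !exprDn -big_split /= -(big_mkord predT (fun i =>
  x ^+ (d.*2.+1 - i) * y ^+ i *+ 'C(d.*2.+1, i) +
  x ^+ (d.*2.+1 - i) * (- y) ^+ i *+ 'C(d.*2.+1, i))).
rewrite -doubleS pairs mulr_sumr; apply: eq_big_nat => b bd.
rewrite !(exprNn y) -(signr_odd _ b.*2) -(signr_odd _ b.*2.+1) /= odd_double /=.
rewrite -!(mulr_natr (_ * _)).
rewrite (_ : d.*2.+1 - b.*2 = (d - b).*2.+1)%N; last by lia.
by ring.
Qed.

Lemma sum_delta (V : nmodType) (G : nat -> V) n c :
  \sum_(0 <= a < n | a == c) G a = if (c < n)%N then G c else 0.
Proof.
rewrite -big_filter; case: ifP => cn.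
  rewrite big_filter big_mkcond (bigD1_seq c) ?mem_index_iota ?iota_uniq //= eqxx.
  by rewrite big1 ?addr0 // => a /negPf ->.
rewrite big_filter big1_seq // => a /andP[/eqP->].
by rewrite mem_index_iota cn.
Qed.

Lemma triangular_sum (V : nmodType) n (f : nat -> nat -> V) :
  \sum_(0 <= a < n) \sum_(0 <= b < n | (a + b < n)%N) f a b =
  \sum_(0 <= d < n) \sum_(0 <= b < d.+1) f (d - b)%N b.
Proof.
transitivity (\sum_(0 <= b < n) \sum_(0 <= d < n)
                \sum_(0 <= a < n | (a + b == d)%N) f a b).
  rewrite (exchange_big_dep predT) //=; apply: eq_bigr => b _.
  rewrite big_mkcond [RHS](exchange_big_dep predT) //=; apply: eq_bigr => a _.
  by under eq_bigl => d do rewrite eq_sym; rewrite sum_delta.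
rewrite exchange_big; apply: eq_big_nat => d /= dn.
rewrite (big_nat_widen 0 d.+1 n) // [RHS]big_mkcond; apply: eq_bigr => b _ /=.
rewrite ltnS; case: leqP => bd.
  have E a : (a + b == d)%N = (a == d - b)%N by lia.
  under eq_bigl => a do rewrite E.
  by rewrite sum_delta (leq_ltn_trans (leq_subr _ _) dn).
rewrite big_pred0 // => a; lia.
Qed.

Section Interpolation.
Variables (F : fieldType) (n : nat).

Definition left_coef m a : F := (\prod_(1 <= l < m) (1 - 'X * (inv_sq l)%:P))`_a.
Definition right_coef m b : F :=
  (\prod_(m.+1 <= l < n.+1) (1 - 'X * (inv_sq l)%:P))`_b.

(** The residue of (-1)^(a+b) zeta({2}^a,1,{2}^b). *)
Definition zeta_2_1_2 a b : F :=
  \sum_(1 <= m < n.+1) left_coef m a * m%:R^-1 * right_coef m b.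

Lemma prod_linear_expand (W : comNzRingType) (f : {rmorphism F -> W}) w
    (y : nat -> F) (r : seq nat) N : (size r < N)%N ->
  \prod_(l <- r) (1 - w * f (y l)) =
  \sum_(0 <= a < N) f (\prod_(l <- r) (1 - 'X * (y l)%:P))`_a * w ^+ a.
Proof.
move=> rN; set P := \prod_(l <- r) (1 - 'X * _).
have -> : \prod_(l <- r) (1 - w * f (y l)) = (map_poly f P).[w].
  rewrite /P rmorph_prod horner_prod; apply: eq_bigr => l _ /=.
  by rewrite rmorphB rmorph1 rmorphM /= map_polyX map_polyC !hornerE /= mulrC.
rewrite (horner_coef_wide (n := N)).
  by rewrite big_mkord; apply: eq_bigr => a _; rewrite coef_map.
rewrite (leq_trans (size_poly _ _)) // (leq_trans (size_prod_linear _ _)) //.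
Qed.

(** Stated over any F-algebra W because u and v will be specialised both to
    elements of F and to polynomials. *)
Lemma gen_fun_expand (W : comNzRingType) (f : {rmorphism F -> W}) (u v : W) :
  \sum_(1 <= m < n.+1) (\prod_(1 <= l < m) (1 - u * f (inv_sq l))) * f m%:R^-1
    * \prod_(m.+1 <= l < n.+1) (1 - v * f (inv_sq l)) =
  \sum_(0 <= a < n) \sum_(0 <= b < n) f (zeta_2_1_2 a b) * u ^+ a * v ^+ b.
Proof.
rewrite /zeta_2_1_2.
transitivity (\sum_(1 <= m < n.+1) \sum_(0 <= a < n) \sum_(0 <= b < n)
   f (left_coef m a * m%:R^-1 * right_coef m b) * u ^+ a * v ^+ b).
  apply: eq_big_nat => m mn; rewrite (prod_linear_expand _ _ _ (N := n)); last first.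
    by rewrite size_iota; lia.
  rewrite [X in _ * X](prod_linear_expand _ _ _ (N := n)); last by rewrite size_iota; lia.
  rewrite -mulrA mulr_suml; apply: eq_bigr => a _; rewrite !mulr_sumr.
  by apply: eq_bigr => b _; rewrite !rmorphM /=; ring.
rewrite exchange_big; apply: eq_bigr => a _ /=; rewrite exchange_big.
apply: eq_bigr => b _ /=; rewrite rmorph_sum !mulr_suml.
by [].
Qed.

Hypothesis charF : n.*2.+1 \in [pchar F].

Lemma coef_squares_eq0 (c : nat -> F) :
    (forall x, x \in squares F n -> \sum_(0 <= a < n) c a * x ^+ a = 0) ->
  forall a, (a < n)%N -> c a = 0.
Proof.
move=> c0 a an.
have q0 : \poly_(i < n) c i = 0.
  apply: (poly_squares_eq0 charF) => [|x /c0 cx]; first exact: size_poly.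
  by rewrite horner_poly -(big_mkord predT (fun i => c i * x ^+ i)).
by have := congr1 (fun q : {poly F} => q`_a) q0; rewrite coef_poly an coef0.
Qed.

(** Two-variable interpolation on the n by n grid of nonzero squares. *)
Lemma coef2_squares_eq0 (c : nat -> nat -> F) :
    (forall x y, x \in squares F n -> y \in squares F n ->
       \sum_(0 <= a < n) \sum_(0 <= b < n) c a b * x ^+ a * y ^+ b = 0) ->
  forall a b, (a < n)%N -> (b < n)%N -> c a b = 0.
Proof.
move=> c0 a b an bn.
apply: (coef_squares_eq0 (c := c a)) bn => y hy.
apply: (coef_squares_eq0 (c := fun a => \sum_(0 <= b < n) c a b * y ^+ b)) an => x hx.
rewrite -[RHS](c0 x y hx hy); apply: eq_bigr => a' _.
by rewrite mulr_suml; apply: eq_bigr => b' _; rewrite mulrAC.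
Qed.

(** Zero for a + b >= n, because the generating function has total degree n-1. *)
Definition zeta_value a b : F :=
  if (a + b < n)%N then 'C((a + b).*2.+1, b.*2)%:R * sign_coef F n (a + b) else 0.

(** The binomial coefficients C(2d+1,2b) come from the part of (x+y)^(2d+1) that
    is even in y. *)
Lemma zeta_value_sum x y :
  2 * (x * \sum_(0 <= a < n) \sum_(0 <= b < n)
         zeta_value a b * (x ^+ 2) ^+ a * (y ^+ 2) ^+ b) =
  \sum_(d < n) sign_coef F n d * (x + y) ^+ d.*2.+1 +
  \sum_(d < n) sign_coef F n d * (x - y) ^+ d.*2.+1.
Proof.
rewrite -big_split /= -(big_mkord predT (fun d =>
   sign_coef F n d * (x + y) ^+ d.*2.+1 + sign_coef F n d * (x - y) ^+ d.*2.+1)).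
transitivity (2 * (x * \sum_(0 <= a < n) \sum_(0 <= b < n | (a + b < n)%N)
   'C((a + b).*2.+1, b.*2)%:R * sign_coef F n (a + b) * (x ^+ 2) ^+ a * (y ^+ 2) ^+ b)).
  congr (_ * (_ * _)); apply: eq_bigr => a _; rewrite [RHS]big_mkcond.
  by apply: eq_bigr => b _; rewrite /zeta_value; case: ifP; rewrite ?mul0r.
rewrite triangular_sum !mulr_sumr; apply: eq_bigr => d _.
rewrite -mulrDr odd_binomial !mulr_sumr; apply: eq_big_nat => b bd.
by rewrite subnK -?exprM ?mul2n ?exprS //; ring.
Qed.

Lemma odd_sum_opp x :
  \sum_(d < n) sign_coef F n d * (- x) ^+ d.*2.+1 =
  - \sum_(d < n) sign_coef F n d * x ^+ d.*2.+1.
Proof.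
rewrite -sumrN; apply: eq_bigr => d _.
by rewrite (exprNn x) -signr_odd /= odd_double; ring.
Qed.

(** Both sides, multiplied by 2N, equal -(h(N+M) + h(N-M)) for the odd function
    h with h(t) = (-1)^t when 0 < t < p; the three cases differ in the sign of
    N - M, hence in the representative of N - M between 0 and p. *)
Lemma gen_fun_eval N M : (0 < N <= n)%N -> (0 < M <= n)%N ->
  gen_fun n (N%:R ^+ 2) (M%:R ^+ 2) =
  \sum_(0 <= a < n) \sum_(0 <= b < n)
     zeta_value a b * (N%:R ^+ 2) ^+ a * (M%:R ^+ 2) ^+ b :> F.
Proof.
move=> hN hM.
have N0 : N%:R != 0 :> F by apply: (natr_neq0 charF); lia.
apply: (mulfI N0); apply: (mulfI (two_neq0 charF)); rewrite zeta_value_sum.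
rewrite -natrD (sign_polynomial charF); last by lia.
case: (ltngtP N M) => NM.
- rewrite (gen_fun_lt charF) ?mulr0 //; try lia.
  rewrite -opprB odd_sum_opp -natrB ?(ltnW NM) // (sign_polynomial charF); last by lia.
  rewrite opprK -(signr_odd _ (N + M)) -(signr_odd _ (M - N)) oddB ?(ltnW NM) //.
  by rewrite oddD addbC addNr.
- rewrite (gen_fun_gt charF) //; try lia.
  rewrite -natrB ?(ltnW NM) // (sign_polynomial charF); last by lia.
  rewrite -(signr_odd _ (N + M)) -(signr_odd _ (N - M)) oddB ?(ltnW NM) //.
  by rewrite oddD; ring.
- rewrite -NM (gen_fun_diag charF) // subrr big1 => [|d _]; last by rewrite expr0n mulr0.
  by rewrite -signr_odd oddD addbb addr0.
Qed.

Lemma zeta_2_1_2E a b : (a < n)%N -> (b < n)%N -> zeta_2_1_2 a b = zeta_value a b.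
Proof.
move=> an bn; apply/eqP; rewrite -subr_eq0; apply/eqP.
apply: (coef2_squares_eq0 (c := fun a b => zeta_2_1_2 a b - zeta_value a b)) an bn.
move=> _ _ /mapP[N + ->] /mapP[M + ->]; rewrite !mem_index_iota => hN hM.
have := gen_fun_expand idfun (N%:R ^+ 2) (M%:R ^+ 2).
rewrite -[LHS]/(gen_fun n (N%:R ^+ 2) (M%:R ^+ 2)) gen_fun_eval // => /eqP.
rewrite eq_sym -subr_eq0 -sumrB => /eqP E; rewrite -[RHS]E; apply: eq_bigr => a' _.
by rewrite -sumrB; apply: eq_bigr => b' _ /=; ring.
Qed.

End Interpolation.

(** * Reduction of the sum with prescribed parities *)

Lemma eqmodr_coef3 (F : comNzRingType) t (a b : {poly {poly {poly F}}}) s i e :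
  eqmodr ('X^t)%:P%:P a b -> (e < t)%N -> a`_s`_i`_e = b`_s`_i`_e.
Proof.
by move=> [c ->] et; rewrite coefD coefCM coefD coefCM coefD coefXnM et addr0.
Qed.

Lemma coef_one_sub_X (R : comNzRingType) b s :
  ((1 - 'X : {poly R}) ^+ b)`_s = (-1) ^+ s * 'C(b, s)%:R.
Proof.
elim: b s => [|b IHb] s.
  by rewrite coef1 bin0n; case: s => [|s]; rewrite ?mulr1 ?mulr0.
rewrite exprSr mulrBr mulr1 coefB coefMX; case: s => [|s] /=.
  by rewrite subr0 IHb !bin0.
by rewrite !IHb binS natrD exprS; ring.
Qed.

(** The contribution of one monomial u^a v^b of the generating function, with
    u = (1-Y) X^2 and v = (1-Z) X^2. *)
Lemma coef3_term (F : comNzRingType) (c : F) a b i s k :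
  let X : {poly F} := 'X in let Y : {poly {poly F}} := 'X in
  let Z : {poly {poly {poly F}}} := 'X in
  (X%:P%:P * ((1 - Y%:P) * (X ^+ 2)%:P%:P) ^+ a * ((1 - Z) * (X ^+ 2)%:P%:P) ^+ b
     * c%:P%:P%:P)`_s`_i`_k =
  if (a + b).*2.+1 == k then c * ((-1) ^+ (i + s) * 'C(a, i)%:R * 'C(b, s)%:R) else 0.
Proof.
move=> X Y Z.
have regroup (W : comNzRingType) (x y z x2 d : W) :
    x * (y * x2) ^+ a * (z * x2) ^+ b * d = x * x2 ^+ (a + b) * d * y ^+ a * z ^+ b.
  by rewrite !exprMn exprD; ring.
rewrite regroup.
have -> : X%:P%:P * (X ^+ 2)%:P%:P ^+ (a + b) * c%:P%:P%:P =
    (X ^+ (a + b).*2.+1 * c%:P)%:P%:P.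
  by rewrite -!rmorphXn /= -!polyCM -exprM -exprS mul2n.
have -> : 1 - Y%:P = (1 - Y)%:P.
  by rewrite polyCB polyC1.
rewrite -rmorphXn /= -polyCM coefCM coef_one_sub_X.
have -> : (-1) ^+ s * 'C(b, s)%:R = ((-1) ^+ s * 'C(b, s)%:R)%:P%:P :> {poly {poly F}}.
  by rewrite !rmorphM !rmorph_sign !rmorph_nat.
rewrite coefMC coefCM coef_one_sub_X.
have -> : (-1) ^+ i * 'C(a, i)%:R = ((-1) ^+ i * 'C(a, i)%:R)%:P :> {poly F}.
  by rewrite rmorphM rmorph_sign rmorph_nat.
rewrite !coefMC coefXn eq_sym; case: eqP => _; last by rewrite !mul0r.
by rewrite exprD /=; ring.
Qed.

Section SumFormula.
Variables (F : fieldType) (n : nat).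
Hypothesis charF : n.*2.+1 \in [pchar F].

Lemma prod_inv_sq_mod k : (k < n.*2)%N ->
  eqmodr 'X^(k.+1) (\prod_(0 <= l < n.+1) (1 - 'X^2 * (inv_sq l : F)%:P)) 1.
Proof.
move=> kn; rewrite big_ltn // [inv_sq 0]/inv_sq invr0 expr0n polyC0 mulr0 subr0 mul1r.
have := congr1 (comp_poly 'X^2) (prod_inv_sq charF).
rewrite rmorph_prod /= rmorphB rmorph1 /= comp_Xn_poly -exprM mul2n => E.
exists (- 'X^(n.*2 - k.+1)).
rewrite mulrN -exprD subnKC // -E; apply: eq_bigr => l _.
by rewrite rmorphB rmorph1 /= comp_polyM comp_polyX comp_polyC.
Qed.

Lemma weighted_gen_fun (W : comNzRingType) (f : {rmorphism F -> W}) (x u v : W) :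
  \sum_(0 <= m < n.+1) (\prod_(0 <= l < m) (1 - u * f (inv_sq l))) * (x * f m%:R^-1)
    * \prod_(m.+1 <= l < n.+1) (1 - v * f (inv_sq l)) =
  \sum_(0 <= a < n) \sum_(0 <= b < n) f (zeta_2_1_2 F n a b) * (x * u ^+ a * v ^+ b).
Proof.
rewrite big_ltn // invr0 rmorph0 mulr0 mulr0 mul0r add0r.
have f0 : f (inv_sq 0) = 0 by rewrite /inv_sq invr0 expr0n rmorph0.
transitivity (x * \sum_(1 <= m < n.+1) (\prod_(1 <= l < m) (1 - u * f (inv_sq l)))
    * f m%:R^-1 * \prod_(m.+1 <= l < n.+1) (1 - v * f (inv_sq l))).
  rewrite mulr_sumr; apply: eq_big_nat => m hm.
  by rewrite big_ltn ?f0 ?mulr0 ?subr0; [ring|lia].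
rewrite gen_fun_expand mulr_sumr; apply: eq_bigr => a _.
by rewrite mulr_sumr; apply: eq_bigr => b _; ring.
Qed.

(** Only the monomials u^a v^b with 2(a+b)+1 = k reach X^k; the signs and the
    first two binomial coefficients come from expanding (1-Y)^a (1-Z)^b. In the
    iterated polynomial ring X is the innermost variable and Z the outermost. *)
Lemma coef_chain_parity k i s : (k < n.*2)%N ->
  (chain_sum (fun j => if j == i then fun m => odd_series k (m%:R^-1 : F)
                       else fun m => even_series k m%:R^-1) (i + s).+1 n.+1)`_k =
  \sum_(0 <= a < n) \sum_(0 <= b < n | (a + b).*2.+1 == k)
     (-1) ^+ (i + s) * 'C(a, i)%:R * 'C(b, s)%:R * zeta_2_1_2 F n a b.
Proof.
move=> kn; rewrite chain_sum_mixed.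
pose f2 : {rmorphism {poly F} -> {poly {poly {poly F}}}} := polyC \o polyC.
pose f3 : {rmorphism F -> {poly {poly {poly F}}}} := polyC \o (polyC \o polyC).
have fM (q : {poly F}) c : f2 (q * c%:P) = q%:P%:P * f3 c by rewrite rmorphM.
have fB c : f2 (1 - 'X^2 * c%:P) = 1 - ('X^2)%:P%:P * f3 c.
  by rewrite rmorphB rmorph1 fM.
have hA l : eqmodr ('X^(k.+1))%:P%:P
    ((even_series k (l%:R^-1 : F))%:P%:P * (1 - ('X^2)%:P%:P * f3 (inv_sq l)))
    (('X^2)%:P%:P * f3 (inv_sq l)).
  rewrite -fB -fM -[_%:P%:P in X in eqmodr _ X]/(f2 _) -rmorphM.
  exact: (eqmodr_morph f2 (even_seriesE k (l%:R^-1 : F))).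
have hB l : eqmodr ('X^(k.+1))%:P%:P
    ((odd_series k (l%:R^-1 : F))%:P%:P * (1 - ('X^2)%:P%:P * f3 (inv_sq l)))
    ('X%:P%:P * f3 l%:R^-1).
  rewrite -fB -fM -[_%:P%:P in X in eqmodr _ X]/(f2 _) -rmorphM.
  exact: (eqmodr_morph f2 (odd_seriesE k (l%:R^-1 : F))).
have h1 : eqmodr ('X^(k.+1))%:P%:P
    (\prod_(0 <= l < n.+1) (1 - ('X^2)%:P%:P * f3 (inv_sq l))) 1.
  have := eqmodr_morph f2 (prod_inv_sq_mod kn).
  by rewrite rmorph1 rmorph_prod; under eq_bigr => l _ do rewrite fB.
rewrite (eqmodr_coef3 _ _ (clear_denominators 'X%:P 'X hA hB h1) (ltnSn k)).
rewrite weighted_gen_fun !coef_sum.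
apply: eq_bigr => a _; rewrite !coef_sum [RHS]big_mkcond.
apply: eq_bigr => b _; rewrite [f3 _ * _]mulrC coef3_term.
by case: ifP; rewrite ?mul0r ?mulr1n // mulrC.
Qed.

End SumFormula.

(** * Return to the residues of the zeta values *)

Lemma coef_prod_series (F : fieldType) r k (ok : 'I_r -> pred nat) (w : 'I_r -> F) :
  (\prod_(j < r) \poly_(e < k.+1) (if ok j e then w j ^+ e else 0))`_k =
  \sum_(s : {ffun 'I_r -> 'I_k.+1} |
          (\sum_(j < r) s j == k)%N && [forall j, ok j (s j)])
     \prod_(j < r) w j ^+ s j.
Proof.
under eq_bigr => j _ do rewrite poly_def.
rewrite bigA_distr_bigA coef_sum [RHS]big_mkcond; apply: eq_bigr => s _ /=.
have -> : \prod_(j < r) ((if ok j (s j) then w j ^+ s j else 0) *: 'X^(s j)) =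
   (\prod_(j < r) (if ok j (s j) then w j ^+ s j else 0)) *:
   'X^(\sum_(j < r) s j) :> {poly F}.
  by rewrite scaler_prod prodrXr.
rewrite coefZ coefXn eq_sym; case: eqP => /= _; last by rewrite mulr0.
rewrite mulr1; case: forallP => [ok_s|nok].
  by apply: eq_bigr => j _; rewrite ok_s.
have /existsP[j nj] : [exists j, ~~ ok j (s j)].
  by rewrite -negb_forall; apply/forallP.
by rewrite (bigD1 j) //= (negPf nj) mul0r.
Qed.

(** The numerator of the constant c, whose denominator is 2^(k-1). *)
Definition parity_num r k i : int :=
  \sum_(0 <= a < k) \sum_(0 <= b < k | (a + b).*2.+1 == k)
     (-1) ^+ r.-1 * 'C(a, i)%:R * 'C(b, r.-1 - i)%:R * 'C(k, b.*2)%:R.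

Section Residues.
Variables (p : prime_index) (n : nat).
Hypothesis pE : val p = n.*2.+1.
Notation F := ('F_(val p)).

Lemma pchar_residue : n.*2.+1 \in [pchar F].
Proof. by rewrite -pE; exact: pchar_Fp (valP p). Qed.

(** The tuples with some m_j = 0 are harmless: as 0^-1 = 0 and the exponents
    are positive, they contribute 0. *)
Lemma zetaA2_residuesE r (s : 'I_r -> nat) : (forall j, 0 < s j)%N ->
  zetaA2_residues s p =
  \sum_(m : {ffun 'I_r -> 'I_(val p)} | [forall j, m j < n.+1]%N && increasing m)
     \prod_(j < r) ((m j)%:R^-1) ^+ s j.
Proof.
move=> s0; rewrite /zetaA2_residues.
have half m : (m.*2 < val p)%N = (m < n.+1)%N by rewrite pE; lia.
rewrite big_mkcond [RHS]big_mkcond; apply: eq_bigr => m _ /=.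
have -> : [forall j, (m j).*2 < val p]%N = [forall j, m j < n.+1]%N.
  exact: eq_forallb.
rewrite -/(increasing m); case: (boolP [forall j, 0 < m j]%N) => [_|] /=.
  by case: ifP => // _; rewrite -prodfV; apply: eq_bigr => j _; rewrite exprVn.
rewrite negb_forall => /existsP[j]; case: ifP => // _.
rewrite -eqn0Ngt => /eqP mj; rewrite (bigD1 j) //= mj invr0 expr0n.
by rewrite (gtn_eqF (s0 j)) mul0r.
Qed.

Lemma zetaA2_residues1 k : (0 < k)%N ->
  zetaA2_residues (fun _ : 'I_1 => k) p = \sum_(1 <= m < n.+1) (m%:R^-1) ^+ k.
Proof.
move=> k0; rewrite zetaA2_residuesE //.
rewrite (@sum_increasing _ _ (fun _ m => (m%:R^-1) ^+ k)); last by rewrite pE; lia.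
rewrite /= big_ltn // invr0 expr0n (gtn_eqF k0) mulr0 add0r.
by apply: eq_bigr => m _; rewrite mul1r.
Qed.

Lemma sum_parity_residues r k (i : 'I_r) : (k < n.*2)%N ->
  \sum_(s : {ffun 'I_r -> 'I_k.+1} |
             [&& (\sum_(j < r) s j == k)%N, [forall j, 0 < s j]%N, odd (s i) &
                 [forall j, (j != i) ==> ~~ odd (s j)]])
       zetaA2_residues (fun j : 'I_r => s j : nat) p =
  \sum_(0 <= a < n) \sum_(0 <= b < n | (a + b).*2.+1 == k)
     (-1) ^+ r.-1 * 'C(a, i)%:R * 'C(b, r.-1 - i)%:R * zeta_2_1_2 F n a b.
Proof.
move=> kn.
have ir : (i + (r.-1 - i)).+1 = r by have := ltn_ord i; lia.
have := coef_chain_parity pchar_residue i (r.-1 - i) kn.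
rewrite ir (_ : i + (r.-1 - i) = r.-1)%N; last by have := ltn_ord i; lia.
move=> <-; rewrite -(@sum_increasing _ (val p)); last by rewrite pE; lia.
rewrite coef_sum.
under eq_bigr => s /and3P[_ /forallP s0 _] do rewrite zetaA2_residuesE //.
rewrite exchange_big /=; apply: eq_bigr => m _.
pose ok (j : 'I_r) (e : nat) := (0 < e)%N && (odd e == (j == i)).
transitivity ((\prod_(j < r) \poly_(e < k.+1)
    (if ok j e then ((m j)%:R^-1 : F) ^+ e else 0))`_k); last first.
  apply: (congr1 (coefp k)); apply: eq_bigr => j _; rewrite /ok -val_eqE /=.
  case: eqP => _; apply/polyP => e; rewrite !coef_poly; case: ifP => // _.
    by rewrite eqb_id; case: e => //= e; rewrite andbT.
  by rewrite eqbF_neg.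
rewrite coef_prod_series; apply: eq_bigl => s; congr (_ && _).
apply/and3P/forallP => [[/forallP s0 si /forallP sj] j|h].
  rewrite /ok s0 /=; case: (eqVneq j i) => [->|ji]; first by rewrite si.
  by have := sj j; rewrite ji /= => /negPf ->.
split; first by apply/forallP => j; have /andP[] := h j.
  by have /andP[_ /eqP] := h i; rewrite eqxx.
apply/forallP => j; apply/implyP => ji; have /andP[_ /eqP ->] := h j; exact: ji.
Qed.

Lemma parity_sum_residue r k (i : 'I_r) : (0 < k <= n)%N ->
  \sum_(s : {ffun 'I_r -> 'I_k.+1} |
             [&& (\sum_(j < r) s j == k)%N, [forall j, 0 < s j]%N, odd (s i) &
                 [forall j, (j != i) ==> ~~ odd (s j)]])
       zetaA2_residues (fun j : 'I_r => s j : nat) p =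
  ratr ((parity_num r k i)%:Q / (2 ^+ k.-1 : int)%:Q) *
  zetaA2_residues (fun _ : 'I_1 => k) p.
Proof.
move=> kn; rewrite sum_parity_residues; last by lia.
rewrite zetaA2_residues1; last by lia.
have two0 := two_neq0 pchar_residue.
have pow2 : ((2 ^+ k.-1 : int)%:~R = 2 ^+ k.-1 :> F) by rewrite rmorphXn.
rewrite ratr_div pow2 ?expf_neq0 // /parity_num.
set Z := \sum_(1 <= m < n.+1) _.
have valueE a b : (a + b).*2.+1 == k -> (a < n)%N -> (b < n)%N ->
    zeta_2_1_2 F n a b = 'C(k, b.*2)%:R * (Z / 2 ^+ k.-1).
  move=> abk an bn; rewrite (zeta_2_1_2E pchar_residue an bn) /zeta_value.
  rewrite ifT; last by move: abk; lia.
  rewrite (eqP abk) /sign_coef (eqP abk) /Z; congr (_ * _).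
  under eq_bigr => m _ do rewrite invfM exprMn.
  rewrite -mulr_sumr mulrA [RHS]mulrC; congr (_ * _).
  have kS : k = k.-1.+1 by lia.
  by rewrite [in LHS]kS exprS mulrA divff // mul1r exprVn.
rewrite raddf_sum /= -mulrA mulr_suml.
rewrite [RHS](big_nat_widen _ _ n) /=; last by lia.
rewrite [RHS]big_mkcond /=; apply: eq_big_nat => a an /=.
case: ltnP => ak; last by rewrite big_pred0 // => b; lia.
rewrite raddf_sum /= mulr_suml [RHS](big_nat_widen _ _ n) /=; last by lia.
rewrite big_nat_cond [RHS]big_nat_cond; apply: eq_big => [b|b].
  by lia.
move=> /andP[bn abk]; rewrite (valueE _ _ abk); [|lia..].
rewrite !rmorphM /= rmorph_sign !rmorph_nat [_^-1 * _]mulrC; ring.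
Qed.

End Residues.

Theorem theorem3p3 (r k : nat) (hrk : (1 <= r <= k)%N) (i : 'I_r) :
  exists c : rat,
    \sum_(s : {ffun 'I_r -> 'I_k.+1} |
             [&& (\sum_(j < r) s j == k)%N, [forall j, 0 < s j]%N, odd (s i) &
                 [forall j, (j != i) ==> ~~ odd (s j)]])
       zetaA2 (fun j : 'I_r => s j : nat)
    = c *: zetaA2 (fun _ : 'I_1 => k).
Proof.
exists ((parity_num r k i)%:Q / (2 ^+ k.-1 : int)%:Q).
rewrite /zetaA2 scale_classA.
have classA0 : classA 0 = 0 by exact: rmorph0.
rewrite -(big_morph classA classAD classA0); apply/classA_eq.
(* For p >= 2k+2 one has p = 2n+1 with n >= k, as the residue identity
   requires. *)
have fin : cardinality.finite_set (classical_sets.preimage (val : prime_index -> nat)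
    (classical_sets.mkset (fun q => (q < k.*2.+2)%N))).
  apply: cardinality.finite_preimage; last exact: cardinality.finite_II.
  by move=> ? ? _ _; exact: val_inj.
apply: cardinality.sub_finite_set fin => p /= ne; rewrite ltnNge; apply/negP => pk.
move/eqP: ne; apply.
rewrite (big_morph (fun x : residues => x p) (fun x y => residuesDE x y p)
  (erefl : _ = 0)).
have {}pk : (k.*2.+2 <= val p)%N := pk.
have pE : val p = (val p)./2.*2.+1.
  by case: (even_prime (valP p)) => h; move: (val p) h pk => q h pk; lia.
apply: (parity_sum_residue pE); lia.
Qed.
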